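(* Let $\Gamma$ be a finite group of order $P$ and $\Delta\subseteq\Gamma$ a set of $d$ distinct non-identity elements generating $\Gamma$, and let $G$ be the Cayley graph of $(\Gamma,\Delta)$. If $G$ has a regular order, then the optimal (minimum) time of a communication graph for universal broadcast on $G$ is $\left\lceil \frac{P-1}{d}\right\rceil$.
   Context: The Cayley graph $G$ has vertex set $\Gamma$ and directed edges $(g,g\delta)$ for $g\in\Gamma$, $\delta\in\Delta$. For $r\ge 0$ let $S_r$ be the set of elements of $\Gamma$ that are products of at most $r$ elements of $\Delta$ (equivalently, endpoints of directed paths of length $\le r$ from the identity $e$), with $S_{-1}=\emptyset$. $G$ has a regular order if there are indexings $\Delta=\{\delta_1,\dots,\delta_d\}$ and $\Gamma=\{g_0,\dots,g_{P-1}\}$ such that (i) $g_0=e$; (ii) if $g_j\in S_r$ and $i<j$ then $g_i\in S_r$; (iii) for every $a\ge0$ and $1\le b\le d$ with $ad+b\le P-1$, there are pairwise distinct $\delta_{i_1},\dots,\delta_{i_b}\in\Delta$ such that for each $1\le c\le b$, $g_{ad+c}\delta_{i_c}^{-1}=g_{s_c}$ with $s_c\le ad$, and if $g_{ad+c}\in S_r\setminus S_{r-1}$ then $g_{s_c}\in S_{r-1}$. A task graph is a finite sequence $(e_i)$ of directed edges of $G$ labeled by positive integer times $t(e_i)$ such that (i) $t(e_i)<t(e_j)$ implies $e_i<e_j$ or $e_i,e_j$ incomparable, and (ii) $t(e_i)=t(e_j)$ implies $i=j$ or $e_i,e_j$ incomparable, where $e_i<e_j$ means there is a directed path in the task graph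 beginning with $e_i$ and ending with $e_j$; its time is its maximum label. A communication graph is a collection of task graphs such that no directed edge carries a given label more than once in the collection; its time is the maximum time of its task graphs. A communication graph for universal broadcast consists, for each vertex $v$, of a task graph containing a directed path from $v$ to every other vertex. *)

(* Defs.v *)
From HB Require Import structures.
From mathcomp Require Import all_boot all_order all_algebra all_fingroup.

Set Implicit Arguments.
Unset Strict Implicit.
Unset Printing Implicit Defensive.

Section CayleyCommunication.

Local Open Scope group_scope.

Variables (gT : finGroupType) (Delta : {set gT}).

(* [Delta ^+ k] is the pointwise power of sets, i.e. the set of products of k
   elements of Delta. *)
Definition ball (r : nat) : {set gT} := \bigcup_(k < r.+1) Delta ^+ k.

(* S_(r-1), with the convention that S_(-1) is empty. *)
Definition ball_pred (r : nat) : {set gT} :=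
  if r is r'.+1 then ball r' else set0.

(* An indexing of a finite set is a list of its elements without repetition.
   In the last clause the paper's index c in 1..b is [c.+1] for [c : 'I_b];
   the generators are indexed from 0. *)
Definition regular_order (dl g : seq gT) : Prop :=
  let d := #|Delta| in
  let g_ j := nth 1 g j in
  let delta_ i := nth 1 dl i in
  [/\ perm_eq dl (enum Delta) /\ perm_eq g (enum [set: gT]),
      g_ 0%N = 1,
      forall r i j : nat,
        j < #|gT| -> g_ j \in ball r -> i < j -> g_ i \in ball r
    & forall a b : nat, 0 < b <= d -> (a * d + b <= #|gT| - 1)%N ->
        exists i : 'I_b -> 'I_d, injective i /\
          forall c : 'I_b, exists s : nat,
            [/\ (s <= a * d)%N,
                g_ (a * d + c.+1)%N * (delta_ (i c))^-1 = g_ s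
              & forall r : nat,
                  g_ (a * d + c.+1)%N \in ball r :\: ball_pred r ->
                  g_ s \in ball_pred r]].

Definition has_regular_order : Prop :=
  exists dl g : seq gT, regular_order dl g.

Definition cayley_edge (e : gT * gT) : bool := e.2 \in e.1 *: Delta.

(* A labeled edge ((x, y), t) is the directed edge x -> y used at time t. *)
Definition labeled_edge : Type := ((gT * gT) * nat)%type.

Definition edge_at (s : seq labeled_edge) (i : 'I_(size s)) : gT * gT :=
  (tnth (in_tuple s) i).1.

Definition time_at (s : seq labeled_edge) (i : 'I_(size s)) : nat :=
  (tnth (in_tuple s) i).2.

(* Since [connect] is reflexive, [precedes i i] holds (the path with the single
   edge e_i); both clauses of [task_graph] are insensitive to this. *)
Definition precedes (s : seq labeled_edge) : rel 'I_(size s) :=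
  connect (fun i j => (edge_at i).2 == (edge_at j).1).

Definition incomparable (s : seq labeled_edge) (i j : 'I_(size s)) : bool :=
  ~~ precedes i j && ~~ precedes j i.

Definition task_graph (s : seq labeled_edge) : Prop :=
  [/\ forall i : 'I_(size s), cayley_edge (edge_at i) /\ 0 < time_at i,
      forall i j : 'I_(size s),
        time_at i < time_at j -> precedes i j \/ incomparable i j
    & forall i j : 'I_(size s),
        time_at i = time_at j -> i = j \/ incomparable i j].

Definition task_time (s : seq labeled_edge) : nat := \max_(e <- s) e.2.

(* The sum counts, with multiplicity, the occurrences in the whole collection
   of a given directed edge with a given label. *)
Definition communication_graph (I : finType) (C : I -> seq labeled_edge) :
    Prop :=
  (forall i, task_graph (C i)) /\
  (forall e : labeled_edge, \sum_(i : I) count_mem e (C i) <= 1).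

Definition communication_time (I : finType) (C : I -> seq labeled_edge) : nat :=
  \max_(i : I) task_time (C i).

Definition has_directed_path (s : seq labeled_edge) (v w : gT) : bool :=
  connect (fun x y => (x, y) \in [seq e.1 | e <- s]) v w.

Definition universal_broadcast (C : gT -> seq labeled_edge) : Prop :=
  communication_graph C /\
  (forall v w : gT, w != v -> has_directed_path (C v) v w).

Definition optimal_broadcast_time (T : nat) : Prop :=
  (exists2 C : gT -> seq labeled_edge,
     universal_broadcast C & communication_time C = T) /\
  (forall C : gT -> seq labeled_edge,
     universal_broadcast C -> T <= communication_time C).

End CayleyCommunication.

(* Main.v *)
Require Import Defs.
From HB Require Import structures.
From mathcomp Require Import all_boot all_order all_algebra all_fingroup.

Set Implicit Arguments.
Unset Strict Implicit.
Unset Printing Implicit Defensive.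

Import Order.TTheory GRing.Theory Num.Theory.

(** Lower bound: each task graph has at least P - 1 edges, and a single time
    step offers only the P * d directed edges of the Cayley graph, so
    P (P - 1) <= P d T.
    Upper bound: a regular order yields a tree rooted at the identity which
    attaches g_(ad+1), ..., g_(ad+d) at time a + 1 to earlier vertices through
    distinct generators.  The left translates of this tree do not conflict: a
    directed edge with its label determines its generator and its block a, hence
    the tree edge of which it is a translate, hence the translating element. *)

Lemma ceil_divn (F : archiRealFieldType) (m n : nat) :
  (0 < n)%N ->
  Num.ceil (m%:R / n%:R : F)%R = Posz ((m + n.-1) %/ n).
Proof.
move=> n0; have n0F : (0 < n%:R :> F)%R by rewrite ltr0n.
apply: ceil_def; rewrite ler_pdivrMr // ltr_pdivlMr //.
set q := _ %/ n.
have lt_q : (q * n < m + n)%N.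
  by rewrite (leq_ltn_trans (leq_divM _ _)) // ltn_add2l ltn_predL.
have le_q : (m <= q * n)%N.
  have := ltn_ceil (m + n.-1) n0; rewrite -/q mulSn addnC.
  by case: (n) n0 => //= k _; rewrite addSn ltnS leq_add2l.
rewrite rmorphB /= mulrBl mul1r ltrBlDr.
by rewrite -!pmulrn -!natrM -natrD ltr_nat ler_nat lt_q le_q.
Qed.

Section LabeledEdges.

Variable gT : finGroupType.

(** Turns the conflict condition into duplicate-freeness of one list: the lower bound can then
    compare list sizes, and the construction only has to show an indexing injective. *)
Lemma sum_count_mem_le1 (I : finType) (C : I -> seq (labeled_edge gT)) :
  (forall e, \sum_(i : I) count_mem e (C i) <= 1) <->
  uniq (flatten [seq C i | i <- enum I]).
Proof.
have sumE e : \sum_(i : I) count_mem e (C i)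
    = count_mem e (flatten [seq C i | i <- enum I]).
  by rewrite count_flatten sumnE !big_map.
split=> [le1 | uniqC e]; last by rewrite sumE count_uniq_mem // leq_b1.
apply: count_mem_uniq => e; have := le1 e; rewrite sumE.
by rewrite -has_pred1 has_count; case: (count _ _) => [|[]].
Qed.

(** Labels that grow from each edge to the next grow along whole directed paths, so an edge
    preceding a different one has a strictly smaller label. Both ordering clauses follow from
    this. *)
Lemma task_graph_increasing (Delta : {set gT}) (s : seq (labeled_edge gT)) :
  {in s, forall e, cayley_edge Delta e.1 /\ 0 < e.2} ->
  {in s &, forall e f, e.1.2 = f.1.1 -> e.2 < f.2} ->
  task_graph Delta s.
Proof.
move=> edges incr.
have precedesP (i j : 'I_(size s)) :
    precedes i j -> i = j \/ time_at i < time_at j.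
  case/connectP=> p; elim: p i => [|k p IHp] i /=; first by left.
  case/andP=> /eqP ik kp j_last; right.
  have lt_ik : time_at i < time_at k by apply: incr; rewrite ?mem_tnth.
  by case: (IHp k kp j_last) => [<- // | /(ltn_trans lt_ik)].
split=> [i | i j lt_ij | i j eq_ij].
- by apply: edges; rewrite mem_tnth.
- rewrite /incomparable; case: (boolP (precedes i j)) => [|_]; first by left.
  right; apply/negP => /precedesP[ji | lt_ji].
    by rewrite ji ltnn in lt_ij.
  by rewrite ltnNge (ltnW lt_ij) in lt_ji.
- case: (eqVneq i j) => [|ij]; [by left | right].
  apply/andP; split; apply/negP => /precedesP[/eqP | ].
  + by rewrite (negPf ij).
  + by rewrite eq_ij ltnn.
  + by rewrite eq_sym (negPf ij).
  + by rewrite eq_ij ltnn.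
Qed.

(** Each vertex other than [v] is the head of the last edge on a path reaching it, so the heads of
    the edges already number at least P - 1. *)
Lemma directed_path_size (s : seq (labeled_edge gT)) (v : gT) :
  (forall w, w != v -> has_directed_path s v w) -> #|gT|.-1 <= size s.
Proof.
move=> reach; rewrite -(cardC1 v) -(size_map (fun e => e.1.2)).
rewrite cardE; apply: uniq_leq_size => [|w]; first exact: enum_uniq.
rewrite mem_enum => wv; have /connectP[p] := reach w wv.
case/lastP: p => [_ /= w_v | p y]; first by rewrite inE w_v eqxx in wv.
rewrite rcons_path last_rcons => /andP[_ /mapP[e es xy_e]] ->.
by apply/mapP; exists e; rewrite // -xy_e.
Qed.

Lemma broadcast_time_lower_bound (Delta : {set gT})
    (C : gT -> seq (labeled_edge gT)) :
  universal_broadcast Delta C ->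
  #|gT|.-1 <= communication_time C * #|Delta|.
Proof.
case=> [[taskC /sum_count_mem_le1 uniqC] reach].
set T := communication_time C.
have P0 : 0 < #|gT| by apply/card_gt0P; exists 1%g.
(* All P * d * T available slots: a source, a generator and a time between 1 and T. *)
pose L := [seq ((x.1, (x.1 * x.2)%g), t) |
             x <- enum (setX [set: gT] Delta), t <- iota 1 T].
have subL : {subset flatten [seq C v | v <- enum gT] <= L}.
  move=> [[x y] t] /flattenP[_ /mapP[v _ ->] ev].
  have [i] : exists i, tnth (in_tuple (C v)) i = ((x, y), t).
    by case/(@tnthP _ _ (in_tuple (C v))): ev => i ->; exists i.
  have [/(_ i) + _ _] := taskC v; rewrite /cayley_edge /edge_at /time_at.
  move=> /[swap] ->; rewrite mem_lcoset /= => -[xy t0].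
  apply/allpairsP; exists ((x, (x^-1 * y)%g), t); split=> /=.
  - by rewrite mem_enum !inE.
  - rewrite mem_iota t0 add1n ltnS /T.
    apply: leq_trans (leq_bigmax v).
    exact: (leq_bigmax_seq _ ev).
  - by rewrite mulKVg.
rewrite -(leq_pmul2l P0) mulnC.
have := uniq_leq_size uniqC subL.
rewrite size_allpairs -cardE cardsX cardsT size_iota -mulnA [_ * T]mulnC.
apply: leq_trans; rewrite size_flatten /shape sumnE !big_map.
rewrite mulnC -sum_nat_const leq_sum // => v _.
exact: directed_path_size (reach v).
Qed.

(* [s j] is the index of the vertex to which g_(j+1) is attached, at time
   j %/ d + 1. *)
Lemma regular_order_parent (Delta : {set gT}) (dl g : seq gT)
    (step := fun k j => ((nth 1 g k)^-1 * nth 1 g j.+1)%g) :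
  (0 < #|gT|.-1 -> 0 < #|Delta|) -> regular_order Delta dl g ->
  exists s : nat -> nat,
    (forall j, j < #|gT|.-1 ->
       s j <= (j %/ #|Delta|) * #|Delta| /\ step (s j) j \in Delta) /\
    (forall j k, j < #|gT|.-1 -> k < #|gT|.-1 ->
       j %/ #|Delta| = k %/ #|Delta| ->
       step (s j) j = step (s k) k -> j = k).
Proof.
set D := #|Delta|; set P1 := #|gT|.-1.
move=> D0 [[dl_enum _] _ _ blocks].
have uniq_dl : uniq dl by rewrite (perm_uniq dl_enum) enum_uniq.
have size_dl : size dl = D by rewrite (perm_size dl_enum) -cardE.
(* Parents are chosen one block at a time. Letting [a] range over the finite type ['I_P1] allows
   finite choice, and suffices because [j %/ D <= j]. *)
have block (a : 'I_P1) : exists s : nat -> nat,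
    (forall c, c < D -> a * D + c < P1 ->
       s c <= a * D /\ step (s c) (a * D + c) \in Delta) /\
    (forall c c', c < D -> c' < D -> a * D + c < P1 -> a * D + c' < P1 ->
       step (s c) (a * D + c) = step (s c') (a * D + c') -> c = c').
  (* The last block may be incomplete; past it [b] is 0 and both claims are vacuous. *)
  set b := minn D (P1 - a * D).
  have ltb c : c < D -> a * D + c < P1 -> c < b.
    by move=> cD cP; rewrite leq_min cD ltn_subRL.
  case: (posnP b) => [b0 | b0].
    by exists id; split=> [c cD /(ltb c cD)|c c' cD _ /(ltb c cD)]; rewrite b0.
  have le_P : a * D + b <= #|gT| - 1.
    have lt_aP : a * D < P1.
      by rewrite -subn_gt0 (leq_trans b0) // geq_minr.
    by rewrite subn1 -/P1 -leq_subRL ?geq_minr // ltnW.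
  have b_range : 0 < b <= D by rewrite b0 geq_minl.
  have [i [i_inj /fin_all_exists[s sP]]] := blocks a b b_range le_P.
  (* The step from parent to child is exactly the generator assigned to [c], so distinctness of
     steps reduces to injectivity of [i]. *)
  have stepE (c : 'I_b) : step (s c) (a * D + c) = nth 1%g dl (i c).
    have [_ s_c _] := sP c.
    by rewrite /step -s_c -addnS invMg invgK -mulgA mulVg mulg1.
  pose s' c := if insub c is Some c' then s c' else 0.
  have s'E (c : 'I_b) : s' c = s c by rewrite /s' valK.
  exists s'; split=> [c cD cP | c c' cD c'D cP c'P].
    rewrite -[c]/(val (Ordinal (ltb c cD cP))) s'E stepE.
    have [-> _ _] := sP (Ordinal (ltb c cD cP)); split=> //.
    by rewrite -mem_enum -(perm_mem dl_enum) mem_nth // size_dl.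
  rewrite -[c]/(val (Ordinal (ltb c cD cP))) s'E stepE.
  rewrite -[c']/(val (Ordinal (ltb c' c'D c'P))) s'E stepE => /eqP.
  by rewrite nth_uniq ?size_dl // => /eqP/val_inj/i_inj ->.
have {block} [s sP] := fin_all_exists block.
(* Glues the blocks along Euclidean division by [D]; the default 0 is never reached when
   [j < P1]. *)
pose s' j := if insub (j %/ D) is Some a then s a (j %% D) else 0.
have s'E (a : 'I_P1) j : j %/ D = a -> s' j = s a (j %% D).
  by rewrite /s' => ->; rewrite valK.
have in_block j : j < P1 -> exists2 a : 'I_P1, j %/ D = a & j %% D < D.
  move=> lt_j; have lt_a : j %/ D < P1 by rewrite (leq_ltn_trans (leq_div _ _)).
  exists (Ordinal lt_a) => //; rewrite ltn_mod D0 //.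
  exact: leq_ltn_trans lt_j.
exists s'; split=> [j lt_j | j k lt_j lt_k].
  have [a ja jD] := in_block j lt_j.
  have [/(_ (j %% D) jD) + _] := sP a.
  by rewrite (s'E a) // -ja -divn_eq; apply.
have [a ja jD] := in_block j lt_j; have [_ _ kD] := in_block k lt_k.
move=> jk; have ka : k %/ D = a by rewrite -jk.
have [_ /(_ (j %% D) (k %% D) jD kD)] := sP a.
rewrite -ja -divn_eq jk -divn_eq !(s'E a) // => /(_ lt_j lt_k) /[apply] mod_jk.
by rewrite (divn_eq j D) jk mod_jk -divn_eq.
Qed.

End LabeledEdges.

Lemma regular_order_broadcast (gT : finGroupType) (Delta : {set gT}) (T : nat) :
  has_regular_order Delta -> #|gT|.-1 <= T * #|Delta| ->
  exists2 C : gT -> seq (labeled_edge gT),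
    universal_broadcast Delta C & communication_time C <= T.
Proof.
case=> dl [g reg] le_PT.
have D0 : 0 < #|gT|.-1 -> 0 < #|Delta|.
  by move/leq_trans/(_ le_PT); rewrite muln_gt0 => /andP[].
have [s [sP s_inj]] := regular_order_parent D0 reg.
case: reg => [[_ g_enum] g0 _ _].
(* The translate by [v] of the tree edge entering g_(j+1). Left translation preserves both the
   generator and the label. *)
pose edge v j : labeled_edge gT :=
  ((v * nth 1 g (s j), v * nth 1 g j.+1)%g, (j %/ #|Delta|).+1).
have uniq_g : uniq g by rewrite (perm_uniq g_enum) enum_uniq.
have size_g : size g = #|gT| by rewrite (perm_size g_enum) -cardE cardsT.
have P0 : 0 < #|gT| by apply/card_gt0P; exists 1%g.
have ltP j : (j < #|gT|.-1) = (j.+1 < #|gT|) by rewrite -{2}(prednK P0).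
have s_le j : j < #|gT|.-1 -> s j <= j.
  by case/sP => /leq_trans le_sj _; apply/le_sj/leq_divM.
exists (fun v => [seq edge v j | j <- iota 0 #|gT|.-1]); last first.
  apply/bigmax_leqP => v _; apply/bigmax_leqP_seq => _ /mapP[j + ->] _.
  rewrite mem_iota add0n => /= lt_j.
  by rewrite ltn_divLR ?(leq_trans lt_j) // D0 // (leq_ltn_trans _ lt_j).
split; [split=> [v|] | move=> v w _].
- apply: task_graph_increasing => [_ /mapP[j + ->] | ].
    rewrite mem_iota add0n => /= /sP[_ stepD]; split=> //.
    by rewrite /cayley_edge mem_lcoset /= invMg mulgA mulgKV.
  move=> _ _ /mapP[j + ->] /mapP[k + ->].
  rewrite !mem_iota !add0n => /= lt_j lt_k /mulgI /eqP.
  have [le_sk _] := sP k lt_k.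
  rewrite nth_uniq // ?size_g -?ltP //; last first.
    by rewrite (leq_ltn_trans (s_le k lt_k)) // (ltn_trans (ltnSn k)) // -ltP.
  (* The parent index [s k] equals [j.+1] and is at most the start of the block of [k], so [j]
     itself lies in a strictly earlier block. *)
  move=> /eqP s_k; rewrite -s_k in le_sk.
  by rewrite ltnS ltn_divLR // D0 // (leq_ltn_trans _ lt_j).
- apply/sum_count_mem_le1; apply: allpairs_uniq.
  + exact: enum_uniq.
  + exact: iota_uniq.
  move=> _ _ /allpairsP[[v j] [_ + ->]] /allpairsP[[w k] [_ + ->]].
  rewrite !mem_iota !add0n /= => lt_j lt_k [Es Ej Et].
  have jk : j = k.
    apply: s_inj => //.
    by rewrite -(mulKg v (nth _ _ j.+1)) Ej mulgA -invMg Es invMg -mulgA mulKg.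
  by move: Ej; rewrite jk => /mulIg ->.
(* Strong induction on the index: g_(j+1) hangs from g_(s j) with [s j <= j], and the root g_0 is
   the identity. *)
have reach j : j < #|gT| ->
    has_directed_path [seq edge v j | j <- iota 0 #|gT|.-1] v (v * nth 1 g j)%g.
  elim/ltn_ind: j => -[|j] IHj; first by rewrite g0 mulg1 => _; apply: connect0.
  rewrite -ltP => lt_j; have le_sj := s_le j lt_j.
  apply: connect_trans (IHj (s j) _ _) (connect1 _); first by rewrite ltnS.
    by rewrite (leq_ltn_trans le_sj) // (ltn_trans (ltnSn j)) // -ltP.
  rewrite -map_comp; apply/mapP; exists j => //.
  by rewrite mem_iota.
have gP : (v^-1 * w)%g \in g by rewrite (perm_mem g_enum) mem_enum inE.
by rewrite -(mulKVg v w) -(nth_index 1%g gP) reach // -size_g index_mem.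
Qed.

Theorem theorem4p5 (gT : finGroupType) (Delta : {set gT}) (P d : nat)
    (cardG : #|gT| = P) (cardD : #|Delta| = d)
    (nontriv : 1%g \notin Delta) (gen : <<Delta>>%g = [set: gT])
    (reg : has_regular_order Delta) :
  exists2 T : nat,
    Posz T = Num.ceil ((P%:R - 1) / d%:R : rat)%R
  & optimal_broadcast_time Delta T.
Proof.
have P0 : 0 < P by rewrite -cardG; apply/card_gt0P; exists 1%g.
(* The ceiling is the least [T] with [P.-1 <= T * d], the inequality that every broadcast satisfies
   and that the construction requires. *)
have [T [ceilT le_PT T_min]] : exists T : nat,
    [/\ Posz T = Num.ceil ((P%:R - 1) / d%:R : rat)%R,
        P.-1 <= T * d & forall t, P.-1 <= t * d -> T <= t].
  (* With no generators the group is trivial, so the numerator P - 1 is 0 and the quotient is 0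
     despite the zero denominator. *)
  case: (posnP d) => [d0 | d0].
    exists 0%N; have P1 : P = 1%N.
      move/eqP: cardD; rewrite d0 cards_eq0 => /eqP D0.
      by rewrite -cardG -cardsT -gen D0 gen0 cards1.
    by rewrite P1 d0 subrr mul0r ceil0.
  exists ((P.-1 + d.-1) %/ d).
  have -> : (P%:R - 1 = P.-1%:R :> rat)%R by rewrite -subn1 natrB.
  rewrite ceil_divn //; split=> // [|t le_t].
    have := ltn_ceil (P.-1 + d.-1) d0; rewrite mulSn addnC.
    by case: (d) d0 => //= k _; rewrite addSn ltnS leq_add2l.
  rewrite -ltnS ltn_divLR // mulSn addnC.
  by rewrite -(prednK d0) addSn ltnS leq_add2l prednK.
have lower C : universal_broadcast Delta C -> T <= communication_time C.
  by move/broadcast_time_lower_bound; rewrite cardG cardD; apply: T_min.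
exists T => //; split=> //.
have [|C univC C_T] := regular_order_broadcast (T := T) reg.
  by rewrite cardG cardD.
by exists C => //; apply/eqP; rewrite eqn_leq C_T lower.
Qed.
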